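(* Let $y>0$, $\delta\in(0,1/3]$, $\alpha\in[0,1)$, and let $\mu$ be a probability density of the interruption time $T$ with support contained in $[(1-\delta)y,(1+\delta)y]$, non-decreasing on $[(1-\delta)y,y]$ and non-increasing on $[y,(1+\delta)y]$. For $\lambda\in[1,2)$ let $k_\lambda(t)=\lfloor\log_2(t/\lambda)\rfloor$, let $L_\lambda=\lambda 2^{k_\lambda((1-\delta)y)-1}$, and let $$q_\lambda=\int_{(1-\delta)y}^{\lambda 2^{k_\lambda((1-\delta)y)+1}}\mu(T)\,dT .$$ Then $$\mathrm{CVaR}_{\alpha,\mu}[\ell(X_\lambda,T)]=\max\left\{\frac{L_\lambda}{1-\alpha}\bigl(2(1-\alpha)-q_\lambda\bigr),\ L_\lambda\right\}.$$ Hence the optimal parameter, i.e. the $\lambda$ minimizing the $\alpha$-consistency $\mathbb{E}_{T\sim\mu}[T]/\mathrm{CVaR}_{\alpha,\mu}[\ell(X_\lambda,T)]$, is $\lambda^*_{\mathrm{CVaR}}=\operatorname{argmax}_{\lambda\in[1,2)}\mathrm{CVaR}_{\alpha,\mu}[\ell(X_\lambda,T)]$.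
   Context: Contract scheduling: for $\lambda\in[1,2)$, the doubling schedule $X_\lambda=(\lambda 2^i)_{i\in\mathbb{Z}}$ is a bi-infinite sequence of contracts executed back to back, so that contract $i$ (of length $\lambda 2^i$) completes at time $\lambda 2^{i+1}$. For an interruption time $T>0$, $\ell(X_\lambda,T)$ is the length of the largest contract of $X_\lambda$ completed by time $T$, namely $\lambda 2^{k_\lambda(T)-1}$. For a random reward $X$ and $\alpha\in[0,1)$, the conditional value-at-risk is $\mathrm{CVaR}_\alpha(X)=\sup_{t\in\mathbb{R}}\{t-\frac{1}{1-\alpha}\mathbb{E}[(t-X)^+]\}$ with $(s)^+=\max\{s,0\}$; $\mathrm{CVaR}_{\alpha,\mu}$ means $T\sim\mu$. *)

(* Defs.v *)
From HB Require Import structures.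
From mathcomp Require Import all_boot all_order all_algebra.
From mathcomp Require Import all_classical all_reals all_analysis.

Set Implicit Arguments.
Unset Strict Implicit.
Unset Printing Implicit Defensive.

Import Order.TTheory GRing.Theory Num.Theory.
Import numFieldNormedType.Exports.

Local Open Scope classical_set_scope.
Local Open Scope ring_scope.

Section schedules.
Context {R : realType}.

(* A schedule is given by the lengths X i (i : int) of its contracts, which
   are executed back to back, so contract i ends after all contracts j <= i. *)
Definition completion_time (X : int -> R) (i : int) : R :=
  limn (series (fun n : nat => X (i - n%:Z))).

(* The value is sup set0 = 0 when no contract is completed by time t. *)
Definition longest_completed (X : int -> R) (t : R) : R :=
  sup [set X i | i in [set i | completion_time X i <= t]].

Definition doubling_schedule (lambda : R) : int -> R :=
  fun i => lambda * 2 ^ i.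

Definition log2 (x : R) : R := ln x / ln 2.

Definition k_index (lambda t : R) : int := Num.floor (log2 (t / lambda)).

Lemma completion_time_doubling (lambda : R) (i : int) :
  completion_time (doubling_schedule lambda) i = lambda * 2 ^ (i + 1).
Proof.
rewrite /completion_time.
have -> : (fun n : nat => doubling_schedule lambda (i - n%:Z)) =
          geometric (lambda * 2 ^ i) 2^-1.
  apply/funext => n.
  by rewrite /doubling_schedule /geometric /= expfzDr// mulrA exprVn exprnN.
apply/cvg_lim => //.
have -> : lambda * 2 ^ (i + 1) = lambda * 2 ^ i * (1 - 2^-1)^-1.
  rewrite expfzDr// expr1z mulrA; congr (_ * _).
  by rewrite {2}[1](splitr 1) div1r addrK invrK.
apply: cvg_geometric_series.
by rewrite gtr0_norm ?invr_gt0// invf_lt1// ltr1n.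
Qed.

Lemma longest_completed_doubling (lambda t : R) : 0 < lambda -> 0 < t ->
  longest_completed (doubling_schedule lambda) t =
  lambda * 2 ^ (k_index lambda t - 1).
Proof.
move=> lambda0 t0; set k := k_index lambda t.
have ln2 : 0 < ln (2 : R) by rewrite ln_gt0// ltr1n.
have tl0 : 0 < t / lambda by rewrite divr_gt0.
have lnX (j : int) : ln ((2 : R) ^ j) = ln 2 * j%:~R.
  case: j => n; rewrite ?NegzE; first by rewrite -exprnP lnXn// mulr_natr.
  by rewrite -exprnN lnV ?posrE ?exprn_gt0// lnXn// mulrNz mulrN mulr_natr.
have completedE (i : int) :
    (completion_time (doubling_schedule lambda) i <= t) = (i + 1 <= k).
  rewrite completion_time_doubling mulrC -ler_pdivlMr//.
  rewrite -ler_ln ?posrE ?exprz_gt0// lnX mulrC -ler_pdivlMr//.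
  by rewrite /k /k_index /log2 floor_ge_int.
rewrite /longest_completed.
apply/eqP; rewrite eq_le; apply/andP; split.
- apply: ge_sup.
    exists (doubling_schedule lambda (k - 1)); exists (k - 1) => //=.
    by rewrite completedE subrK.
  move=> _ [i /= + <-]; rewrite completedE => ik.
  by rewrite /doubling_schedule ler_pM2l// ler_eXz2l ?ltr1n// lerBrDr.
- apply: ub_le_sup; last first.
    by exists (k - 1) => //=; rewrite completedE subrK.
  exists (lambda * 2 ^ (k - 1)) => _ [i /= + <-]; rewrite completedE => ik.
  by rewrite /doubling_schedule ler_pM2l// ler_eXz2l ?ltr1n// lerBrDr.
Qed.

End schedules.

Section probability.
Context {R : realType}.
Local Open Scope ereal_scope.

Definition probability_density (mu : R -> R) : Prop :=
  [/\ measurable_fun setT mu, (forall x, 0 <= mu x)%R &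
      \int[lebesgue_measure]_x (mu x)%:E = 1].

Context {d : measure_display} {Omega : measurableType d}.
Variable P : probability Omega R.

Definition has_density (T : {RV P >-> R}) (mu : R -> R) : Prop :=
  forall A : set R, measurable A ->
    distribution P T A = \int[lebesgue_measure]_(x in A) (mu x)%:E.

Definition CVaR (alpha : R) (X : Omega -> R) : \bar R :=
  ereal_sup [set t%:E - ((1 - alpha)^-1)%:E *
                        'E_P[fun w => (Num.max (t - X w) 0)%R] | t in [set: R]].

Definition consistency (alpha : R) (T : {RV P >-> R}) (X : int -> R) : \bar R :=
  'E_P[T] / CVaR alpha (longest_completed X \o T).

End probability.

Section extremal_points.
Context {R : realType}.
Local Open Scope ereal_scope.

Definition argmax_on (D : set R) (f : R -> \bar R) : set R :=
  [set x | D x /\ forall x', D x' -> f x' <= f x].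

Definition argmin_on (D : set R) (f : R -> \bar R) : set R :=
  [set x | D x /\ forall x', D x' -> f x <= f x'].

End extremal_points.

(* Main.v *)
Require Import Defs.
From HB Require Import structures.
From mathcomp Require Import all_boot all_order all_algebra.
From mathcomp Require Import all_classical all_reals all_analysis.
From mathcomp Require Import measurable_realfun.
From mathcomp Require Import ring lra.

Import Order.TTheory GRing.Theory Num.Theory.
Import numFieldNormedType.Exports.

Local Open Scope classical_set_scope.
Local Open Scope ring_scope.

(* Since delta <= 1/3, the support [a, b] of mu has b <= 2 a, so at most one
   contract completes strictly after a and by time b: almost surely the reward
   is L (probability q) or 2 L.  The objective t - E[(t - X)^+] / (1 - alpha) of
   the CVaR is then concave and piecewise linear in t with breakpoints L and
   2 L, increasing before L and nonincreasing after 2 L, hence the formula.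
   E[T] is finite and positive and the CVaR is positive, so minimizing their
   quotient amounts to maximizing the CVaR.  For the existence of a maximizer,
   lambda is reparametrized by the first completion time c after a, which
   ranges over ]a, 2 a]; the CVaR is continuous in c, extends to c = a, and the
   extended value at a does not exceed the value at 2 a. *)

(** * The doubling schedule on an octave [[a, 2 * a]] *)

Section doubling_schedule.
Context {R : realType}.
Implicit Types (lambda t a : R) (k : int).

(** Trades the floor of a logarithm for a comparison with a power of 2; all later facts on [k_index]
    go through it. *)
Lemma le_k_index lambda t k : 0 < lambda -> 0 < t ->
  (k <= k_index lambda t) = (lambda * 2 ^ k <= t).
Proof.
move=> lambda0 t0.
have ln2 : 0 < ln (2 : R) by rewrite ln_gt0// ltr1n.
have lnX : ln ((2 : R) ^ k) = ln 2 * k%:~R.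
  case: k => n; rewrite ?NegzE; first by rewrite -exprnP lnXn// mulr_natr.
  by rewrite -exprnN lnV ?posrE ?exprn_gt0// lnXn// mulrNz mulrN mulr_natr.
rewrite /k_index floor_ge_int /log2 ler_pdivlMr// mulrC -lnX.
by rewrite ler_ln ?posrE ?exprz_gt0 ?divr_gt0// ler_pdivlMr// mulrC.
Qed.

Lemma k_index_eq lambda t k : 0 < lambda ->
  lambda * 2 ^ k <= t < lambda * 2 ^ (k + 1) -> k_index lambda t = k.
Proof.
move=> lambda0 /andP[kt tk].
have t0 : 0 < t by rewrite (lt_le_trans _ kt)// mulr_gt0// exprz_gt0.
apply/eqP; rewrite eq_le le_k_index// kt andbT.
by rewrite -ltzD1 ltNge le_k_index// -ltNge.
Qed.

Lemma k_index_itv lambda t : 0 < lambda -> 0 < t ->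
  lambda * 2 ^ k_index lambda t <= t < lambda * 2 ^ (k_index lambda t + 1).
Proof.
move=> lambda0 t0; rewrite -le_k_index// lexx/=.
by rewrite ltNge -le_k_index// -ltNge ltzD1.
Qed.

(** Serves to make the reward measurable in [T], hence is proved on the whole line. *)
Lemma longest_completed_nondecreasing lambda : 0 < lambda ->
  {homo longest_completed (doubling_schedule lambda) : s t / s <= t}.
Proof.
move=> lambda0 s t st.
(* All completion times are positive, so for [u <= 0] the reward is the default value of [sup] on
   the empty set. *)
have nonpos u : u <= 0 -> longest_completed (doubling_schedule lambda) u = 0.
  move=> u0; rewrite /longest_completed -[RHS]sup0; congr sup.
  apply/seteqP; split=> [_ [i /= + _]|//].
  rewrite completion_time_doubling => iu.
  by have := le_trans iu u0; rewrite leNgt mulr_gt0// exprz_gt0.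
have [s0|s0] := leP s 0; last first.
  have t0 := lt_le_trans s0 st.
  rewrite !longest_completed_doubling// ler_pM2l// ler_eXz2l ?ltr1n// lerD2r.
  rewrite le_k_index// (le_trans _ st)//.
  by case/andP: (k_index_itv _ _ lambda0 s0).
rewrite nonpos//; have [t0|t0] := leP t 0; first by rewrite nonpos.
by rewrite longest_completed_doubling// mulr_ge0 ?exprz_ge0 ?ltW.
Qed.

(** The first completion time [s] after [a] satisfies [a < s], so the next one, [2 * s], lies beyond
    [2 * a]: the reward jumps at most once. *)
Lemma longest_completed_within_octave lambda a t : 0 < lambda -> 0 < a ->
  a <= t <= 2 * a ->
  let L := lambda * 2 ^ (k_index lambda a - 1) in
  longest_completed (doubling_schedule lambda) t =
  if t < lambda * 2 ^ (k_index lambda a + 1) then L else 2 * L.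
Proof.
move=> lambda0 a0 /andP[at_ t2a] L.
have /andP[ka ak] := k_index_itv _ _ lambda0 a0.
have t0 := lt_le_trans a0 at_; rewrite longest_completed_doubling//.
case: ltP => [tk|kt].
  by rewrite (k_index_eq lambda t (k_index lambda a))// tk (le_trans ka).
rewrite (k_index_eq lambda t (k_index lambda a + 1))//.
  by rewrite addrAC expfzDr// expr1z mulrA mulrC.
by rewrite kt/= expfzDr// expr1z (le_lt_trans t2a)// mulrA mulrC ltr_pM2r.
Qed.

(** The witness is the binary mantissa of [x]: dividing by the largest power of 2 below [x] lands in
    [[1, 2[]. The exponent is also that of [a], because [x <= a < 2 * x]. *)
Lemma octave_parametrization a x : 0 < a -> a / 2 < x <= a ->
  exists lambda, [/\ 1 <= lambda, lambda < 2 &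
                     lambda * 2 ^ k_index lambda a = x].
Proof.
move=> a0 /andP[ax xa].
have x0 : 0 < x by rewrite (lt_trans _ ax)// divr_gt0.
have := k_index_itv 1 x ltr01 x0; rewrite !mul1r; set k := k_index 1 x.
rewrite expfzDr// expr1z => /andP[kx xk].
have k0 : 0 < (2 : R) ^ k by rewrite exprz_gt0.
have lambda1 : 1 <= x / 2 ^ k by rewrite ler_pdivlMr// mul1r.
exists (x / 2 ^ k); split => //.
  by rewrite ltr_pdivrMr// mulrC.
rewrite (k_index_eq _ _ k) ?divfK ?gt_eqF// ?(lt_le_trans ltr01)//.
by rewrite expfzDr// mulrA divfK ?gt_eqF// xa/= expr1z -ltr_pdivrMr.
Qed.

End doubling_schedule.

(** * Expectation and CVaR of random rewards *)

Section conditional_value_at_risk.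
Context {R : realType} {d : measure_display} {Omega : measurableType d}.
Variable P : probability Omega R.
Local Open Scope ereal_scope.

Lemma ge0_expectation_ae_two_valued (Z : Omega -> R) (A : set Omega) (l h : R) :
  measurable_fun setT Z -> measurable A -> (forall w, 0 <= Z w)%R ->
  (0 <= l)%R -> (0 <= h)%R ->
  {ae P, forall w, Z w = if w \in A then l else h} ->
  'E_P[Z] = (l * fine (P A) + h * (1 - fine (P A)))%:E.
Proof.
move=> mZ mA Z0 l0 h0 Zlh; rewrite unlock.
have mE D : measurable_fun D (EFin \o Z).
  exact/measurable_EFinP/measurable_funTS.
rewrite -(setUv A) ge0_integral_setU//; last 3 first.
- exact: measurableC.
- by move=> w _; rewrite lee_fin.
- by apply/disj_set2P; rewrite setICr.
have PA : P A = (fine (P A))%:E by rewrite fineK// fin_num_measure.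
have PC : P (~` A) = (1 - fine (P A))%:E.
  by rewrite probability_setC// {1}PA.
rewrite EFinD !EFinM -PA -PC -!integral_cst//; last exact: measurableC.
congr (_ + _); apply: ge0_ae_eq_integral => //.
- by move=> w _; rewrite lee_fin.
- by apply: filterS Zlh => w Zw Aw; rewrite Zw/= ifT// mem_set.
- exact: measurableC.
- by move=> w _; rewrite lee_fin.
- by apply: filterS Zlh => w Zw Aw; rewrite Zw/= ifF// memNset.
Qed.

Lemma CVaR_ae_two_valued (alpha : R) (X : Omega -> R) (A : set Omega)
    (l h : R) :
  (0 <= alpha < 1)%R -> measurable_fun setT X -> measurable A -> (l <= h)%R ->
  {ae P, forall w, X w = if w \in A then l else h} ->
  CVaR P alpha X =
  (Num.max (h - (1 - alpha)^-1 * (fine (P A) * (h - l))) l)%:E.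
Proof.
move=> /andP[alpha0 alpha1] mX mA lh Xlh; set p := fine (P A).
have p0 : (0 <= p)%R by rewrite fine_ge0.
have p1 : (p <= 1)%R.
  by rewrite -lee_fin fineK ?fin_num_measure// probability_le1.
have [b1 b0] : (1 <= (1 - alpha)^-1 /\ 0 < (1 - alpha)^-1)%R.
  have : (0 < 1 - alpha)%R by rewrite subr_gt0.
  by move=> a0; rewrite invr_gt0 invf_ge1// lerBlDr lerDl.
set b := (1 - alpha)^-1%R in b1 b0 *.
(* The CVaR objective, with the expectation computed from the two values of [X]. *)
pose obj t := (t - b * (Num.max (t - l) 0 * p + Num.max (t - h) 0 * (1 - p)))%R.
have objE (t : R) :
    t%:E - b%:E * 'E_P[fun w => (Num.max (t - X w) 0)%R] = (obj t)%:E.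
  rewrite (ge0_expectation_ae_two_valued _ A (Num.max (t - l) 0)%R
    (Num.max (t - h) 0)%R)//.
  - by apply: measurable_maxr => //; exact: measurable_funB.
  - by move=> w; rewrite le_max lexx orbT.
  - by rewrite le_max lexx orbT.
  - by rewrite le_max lexx orbT.
  - by apply: filterS Xlh => w ->; case: ifP.
have objl : obj l = l.
  rewrite /obj subrr maxxx mul0r add0r (@max_r _ _ (l - h)%R) ?subr_le0//.
  by rewrite mul0r mulr0 subr0.
have objh : obj h = (h - b * (p * (h - l)))%R.
  rewrite /obj subrr maxxx mul0r addr0 (@max_l _ _ (h - l)%R) ?subr_ge0//.
  by rewrite (mulrC p).
apply/eqP; rewrite eq_le; apply/andP; split.
  apply: ge_ereal_sup => _ [t _ <-]; rewrite objE lee_fin le_max.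
  rewrite /obj.
  have [tl|lt] := leP t l.
    rewrite (@max_r _ _ (t - l)%R) ?subr_le0//.
    rewrite (@max_r _ _ (t - h)%R); last first.
      by rewrite subr_le0 (le_trans tl).
    by rewrite !mul0r addr0 mulr0 subr0 tl orbT.
  rewrite (@max_l _ _ (t - l)%R) ?subr_ge0 ?(ltW lt)//.
  have [th|ht] := leP t h.
    rewrite (@max_r _ _ (t - h)%R) ?subr_le0// mul0r addr0.
    (* Between [l] and [h] the slope is [1 - b * p]; its sign tells which endpoint dominates. *)
    have [bp|bp] := leP (b * p)%R 1%R.
      apply/orP; left; have : (0 <= (h - t) * (1 - b * p))%R.
        by rewrite mulr_ge0 ?subr_ge0.
      lra.
    apply/orP; right; have : (0 <= (t - l) * (b * p - 1))%R.
      by rewrite mulr_ge0 ?subr_ge0 ?ltW.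
    lra.
  rewrite (@max_l _ _ (t - h)%R) ?subr_ge0 ?(ltW ht)//.
  (* Beyond [h] the slope is [1 - b], which is nonpositive since [1 <= b]. *)
  apply/orP; left; have : (0 <= (t - h) * (b - 1))%R.
    by rewrite mulr_ge0 ?subr_ge0 ?(ltW ht).
  lra.
have [_|_] := leP l (h - b * (p * (h - l)))%R.
  by rewrite -objh -objE; apply: ereal_sup_ubound; exists h.
by rewrite -[X in X%:E]objl -objE; apply: ereal_sup_ubound; exists l.
Qed.

Lemma expectation_ae_itv (X : {RV P >-> R}) (a b : R) : (0 < a <= b)%R ->
  {ae P, forall w, a <= X w <= b}%R ->
  exists2 e : R, (0 < e)%R & 'E_P[X] = e%:E.
Proof.
move=> /andP[a0 ab] Xab.
(* Clamping [X] to [[a, b]] turns the almost sure bounds into bounds everywhere without changing the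
   expectation. *)
pose Y w := Num.max a (Num.min (X w) b).
have mY : measurable_fun setT Y.
  by apply: measurable_maxr => //; apply: measurable_minr.
have XY : 'E_P[X] = \int[P]_w (Y w)%:E.
  rewrite unlock; apply: ae_eq_integral => //.
  - exact/measurable_EFinP.
  - exact/measurable_EFinP.
  - apply: filterS Xab => w /andP[aX Xb] _.
    by rewrite /Y (min_idPl Xb) (max_idPr aX).
have aY w : (a <= Y w)%R by rewrite le_max lexx.
have Yb w : (Y w <= b)%R by rewrite ge_max ab ge_min lexx orbT.
have lower : a%:E <= 'E_P[X].
  rewrite XY -[a%:E]mule1 -(@probability_setT _ _ _ P) -integral_cst//.
  apply: ge0_le_integral => //.
  - by move=> w _; rewrite lee_fin ltW.
  - exact/measurable_EFinP.
  - by move=> w _; rewrite lee_fin.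
have upper : 'E_P[X] <= b%:E.
  rewrite XY -[b%:E]mule1 -(@probability_setT _ _ _ P) -integral_cst//.
  apply: ge0_le_integral => //.
  - by move=> w _; rewrite lee_fin (le_trans _ (aY w))// ltW.
  - exact/measurable_EFinP.
  - by move=> w _; rewrite lee_fin.
have fE : 'E_P[X] \is a fin_num.
  rewrite fin_real// (lt_le_trans _ lower) ?ltNyr//=.
  by rewrite (le_lt_trans upper)// ltry.
exists (fine 'E_P[X]); last by rewrite fineK.
by rewrite -lte_fin fineK// (lt_le_trans _ lower)// lte_fin.
Qed.

End conditional_value_at_risk.

(** Real positive values of [f] reduce the extended quotient to a real one, where inversion reverses
    the order. *)
Lemma argmin_on_div_argmax_on {R : realType} (D : set R) (e : R)
    (f : R -> \bar R) (r : R -> R) : (0 < e)%R -> (forall x, D x -> f x = (r x)%:E) ->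
    (forall x, D x -> (0 < r x)%R) ->
  argmin_on D (fun x => e%:E / f x)%E = argmax_on D f.
Proof.
move=> e0 fr r0.
have le_div x x' : D x -> D x' ->
    ((e%:E / f x <= e%:E / f x') = (f x' <= f x))%E.
  move=> Dx Dx'; rewrite !fr// !inver !gt_eqF ?r0// -!EFinM !lee_fin.
  by rewrite ler_pM2l// lef_pV2// posrE r0.
apply/seteqP; split=> x [Dx xopt]; split=> // x' Dx'.
  by rewrite -le_div// xopt.
by rewrite le_div// xopt.
Qed.

(** * The law of [T], and maximization over the completion time *)

Section interruption_density.
Context {R : realType}.
Local Notation leb := (@lebesgue_measure R).

(** Extended by zero outside [A] and [B], the two integrands coincide. *)
Lemma eq_integral_support (f : R -> R) (A B : set R) :
  (forall x, f x != 0 -> A x <-> B x) ->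
  (\int[leb]_(x in A) (f x)%:E = \int[leb]_(x in B) (f x)%:E)%E.
Proof.
move=> AB; rewrite integral_mkcond [RHS]integral_mkcond.
apply: eq_integral => x _; rewrite /patch.
have [fx0|fx0] := eqVneq (f x) 0; first by rewrite fx0; do 2 case: ifP.
by rewrite (_ : (x \in A) = (x \in B))//;
  apply/idP/idP; rewrite !inE => /AB; apply.
Qed.

Context {d : measure_display} {Omega : measurableType d}.
Context {P : probability Omega R} {T : {RV P >-> R}} {mu : R -> R} {a b : R}.
Context (mu_density : probability_density mu) (T_mu : has_density T mu).
Context (mu_supp : [set x | mu x != 0] `<=` `[a, b]).

Lemma integrable_density (A : set R) : measurable A ->
  leb.-integrable A (EFin \o mu).
Proof.
case: mu_density => mmu mu0 mu1 mA.
apply: (@integrableS _ _ _ _ setT) => //.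
apply/integrableP; split; first exact/measurable_EFinP.
under eq_integral => x _ do rewrite /= ger0_norm//.
by rewrite mu1 ltry.
Qed.

Lemma density_ae_itv : {ae P, forall w, a <= T w <= b}.
Proof.
case: mu_density => mmu mu0 mu1.
have Pab : P (T @^-1` `[a, b]) = 1%E.
  rewrite -[LHS]/(distribution P T `[a, b]) T_mu// -mu1.
  by apply: eq_integral_support => x /mu_supp.
exists (~` (T @^-1` `[a, b])); split.
- apply: measurableC.
  by rewrite -[X in measurable X]setTI; exact: measurable_funP.
- rewrite probability_setC ?Pab ?subee//.
  by rewrite -[X in measurable X]setTI; exact: measurable_funP.
- by apply: subsetC => w /=; rewrite in_itv.
Qed.

Lemma density_lt (s : R) :
  fine (P (T @^-1` `]-oo, s[)) = \int[leb]_(x in `[a, s]) mu x.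
Proof.
case: mu_density => mmu mu0 mu1.
rewrite -[P _]/(distribution P T `]-oo, s[) T_mu// /Rintegral; congr fine.
(* The event is strict, since a contract ending exactly at [s] counts as completed; the endpoint is
   a null set for the integral. *)
rewrite -integral_itv_bndo_bndc; last first.
  exact/measurable_EFinP/measurable_funTS.
apply: eq_integral_support => x /mu_supp /=.
by rewrite !in_itv/= => /andP[-> _].
Qed.

End interruption_density.

(** Here [c] stands for the first completion time after [a], [c / 4] for the smaller reward and
    [F c] for its probability. *)
Lemma two_point_CVaR_attains_max {R : realType} (a alpha : R) (F : R -> R) :
  0 < a -> alpha < 1 -> {within `[a, 2 * a], continuous F} -> F a = 0 ->
  let g c := Num.max (c / 4 / (1 - alpha) * (2 * (1 - alpha) - F c)) (c / 4) in
  exists2 c, a < c <= 2 * a & forall c', a < c' <= 2 * a -> g c' <= g c.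
Proof.
move=> a0 alpha1 cF Fa g.
have cg : {within `[a, 2 * a], continuous g}.
  move=> x; apply: (@continuous_max R (subspace `[a, 2 * a])
    (fun c => c / 4 / (1 - alpha) * (2 * (1 - alpha) - F c)) (fun c => c / 4)).
    apply: cvgM.
      apply: cvgM; last exact: cvg_cst.
      apply: cvgM; last exact: cvg_cst.
      by apply: continuous_subspaceT => z; exact: cvg_id.
    apply: cvgB; first exact: cvg_cst.
    exact: cF.
  apply: cvgM; last exact: cvg_cst.
  by apply: continuous_subspaceT => z; exact: cvg_id.
have a2a : a <= 2 * a by lra.
have [c + cmax] := EVT_max a2a cg.
rewrite in_itv/= => /andP[ac c2a].
have cmax' c' : a < c' <= 2 * a -> g c' <= g c.
  by move=> /andP[/ltW ac' c2a']; rewrite cmax// in_itv/= ac'.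
have [ac'|] := ltP a c; first by exists c; rewrite ?ac'.
move=> ca; have {ac c2a ca}cE : c = a by apply/eqP; rewrite eq_le ca.
(* A maximum at the excluded endpoint moves to [2 * a]: [F a = 0] gives [g a = a / 2], which is
   [(2 * a) / 4 <= g (2 * a)]. *)
exists (2 * a); first by apply/andP; split=> //; lra.
move=> c' /cmax' /le_trans; apply; rewrite cE.
apply: (@le_trans _ _ (a / 2)); last by rewrite le_max; apply/orP; right; lra.
have b0 : 1 - alpha != 0 by rewrite subr_eq0 gt_eqF.
rewrite ge_max Fa [X in X <= _](_ : _ = a / 2); last by field.
by rewrite lexx /=; lra.
Qed.

(** * CVaR formula and optimal parameter *)

Theorem theorem6 (R : realType) (d : measure_display) (Omega : measurableType d)
    (P : probability Omega R) (T : {RV P >-> R}) (mu : R -> R)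
    (y delta alpha : R)
    (y_gt0 : 0 < y)
    (delta_gt0 : 0 < delta) (delta_le : delta <= 1 / 3)
    (alpha_ge0 : 0 <= alpha) (alpha_lt1 : alpha < 1)
    (mu_density : probability_density mu)
    (T_mu : has_density T mu)
    (mu_supp : [set x | mu x != 0] `<=` `[(1 - delta) * y, (1 + delta) * y])
    (mu_nondecr : {in `[(1 - delta) * y, y] &, {homo mu : u v / u <= v}})
    (mu_nonincr : {in `[y, (1 + delta) * y] &, {homo mu : u v /~ u <= v}}) :
  let a := (1 - delta) * y in
  let L (lambda : R) := lambda * 2 ^ (k_index lambda a - 1) in
  let q (lambda : R) :=
    \int[lebesgue_measure]_(x in `[a, lambda * 2 ^ (k_index lambda a + 1)]) mu x in
  let reward_CVaR (lambda : R) :=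
    CVaR P alpha (longest_completed (doubling_schedule lambda) \o T) in
  (forall lambda : R, 1 <= lambda -> lambda < 2 ->
     reward_CVaR lambda =
     (Num.max (L lambda / (1 - alpha) * (2 * (1 - alpha) - q lambda))
              (L lambda))%:E) /\
  (argmin_on `[1, 2[ (fun lambda => consistency alpha T (doubling_schedule lambda))
     = argmax_on `[1, 2[ reward_CVaR /\
   argmax_on `[1, 2[ reward_CVaR !=set0).
Proof.
move=> a L q reward_CVaR.
have a0 : 0 < a by rewrite mulr_gt0// subr_gt0; lra.
(* This is [1 + delta <= 2 * (1 - delta)], that is, [delta <= 1 / 3]. *)
have b2a : (1 + delta) * y <= 2 * a by rewrite /a mulrA ler_pM2r//; lra.
have ab : a <= (1 + delta) * y by rewrite /a ler_pM2r//; lra.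
have Tab := density_ae_itv mu_density T_mu mu_supp.
have L_gt0 lambda : 1 <= lambda -> 0 < L lambda.
  by move=> lambda1; rewrite mulr_gt0 ?exprz_gt0// (lt_le_trans ltr01).
have alpha01 : 0 <= alpha < 1 by rewrite alpha_ge0.
have CVaRE lambda : 1 <= lambda -> lambda < 2 -> reward_CVaR lambda =
    (Num.max (L lambda / (1 - alpha) * (2 * (1 - alpha) - q lambda))
             (L lambda))%:E.
  move=> lambda1 _; have lambda0 := lt_le_trans ltr01 lambda1.
  set s := lambda * 2 ^ (k_index lambda a + 1).
  rewrite /reward_CVaR.
  rewrite (CVaR_ae_two_valued P alpha _ (T @^-1` `]-oo, s[) (L lambda)
    (2 * L lambda))//.
  - rewrite (density_lt mu_density T_mu mu_supp) -/(q lambda).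
    congr (Num.max _ _)%:E.
    by field; rewrite subr_eq0 gt_eqF.
  - apply: measurableT_comp => //; apply: nondecreasing_measurable => //.
    exact: longest_completed_nondecreasing.
  - by rewrite -[X in measurable X]setTI; exact: measurable_funP.
  - by have := L_gt0 _ lambda1; lra.
  - apply: filterS Tab => w /andP[aT Tb] /=.
    rewrite (longest_completed_within_octave _ a)// ?aT ?(le_trans Tb)//.
    rewrite -/s -/(L lambda).
    by rewrite (_ : (w \in _) = (T w < s))//;
      apply/idP/idP; rewrite inE/= in_itv.
split=> //; split.
  have [|e e0 Te] := expectation_ae_itv P T a ((1 + delta) * y) _ Tab.
    by rewrite a0.
  rewrite /consistency Te.
  apply: (argmin_on_div_argmax_on `[1, 2[ e reward_CVaR _ e0).
    by move=> lambda /=; rewrite in_itv/= => /andP[l1 l2]; exact: CVaRE.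
  move=> lambda /=; rewrite in_itv/= => /andP[l1 _].
  by rewrite lt_max L_gt0 ?orbT.
have intmu := integrable_density mu_density `[a, 2 * a].
have [||c /andP[ac c2a] cmax] := two_point_CVaR_attains_max a alpha
    (fun s => \int[lebesgue_measure]_(x in `[a, s]) mu x) a0 alpha_lt1.
(* An integral of an integrable function is continuous in its upper endpoint. *)
- apply: parameterized_integral_continuous; first by lra.
  exact: intmu.
- by rewrite set_itv1 Rintegral_set1.
(* The exponents [k - 1] and [k + 1] differ by 2, whence the factor 4. *)
have LE lambda : L lambda = lambda * 2 ^ (k_index lambda a + 1) / 4.
  rewrite /L (@expfzDr _ 2 _ (- 1))// (@expfzDr _ 2 _ 1)// expr1z.
  by rewrite -[2 ^ (- 1)]/(2^-1); move: (2 ^ _) => u; lra.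
(* The parametrization concerns [lambda * 2 ^ k], which is half of the completion time [c]. *)
have [|lambda [lambda1 lambda2 lambdac]] := octave_parametrization a (c / 2) a0.
  by apply/andP; split; lra.
have {}lambdac : lambda * 2 ^ (k_index lambda a + 1) = c.
  by rewrite expfzDr// expr1z mulrA lambdac divfK.
exists lambda; split=> [|lambda' /=]; first by rewrite /= in_itv/= lambda1.
rewrite in_itv/= => /andP[lambda'1 lambda'2]; rewrite !CVaRE// lee_fin.
rewrite !LE /q lambdac cmax//.
have lambda'0 := lt_le_trans ltr01 lambda'1.
have /andP[ka ->] := k_index_itv lambda' a lambda'0 a0.
by rewrite expfzDr// expr1z mulrA mulrC ler_pM2l.
Qed.
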